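(* Let $P(z)\in\mathbb{C}[z]$ be a homogeneous harmonic polynomial of degree $d\ge2$ written as $P(z)=\sum_{i=1}^kh_{\alpha_i}^d(z)$ with $\alpha_1,\dots,\alpha_k\in\mathbb{C}^n$ isotropic and $h_{\alpha_1}^d,\dots,h_{\alpha_k}^d$ linearly independent. Then for every tree $T$, $$Q_{T,P}=\sum_{f\in\Omega(T,\mathcal{G}(P))}\ \sum_{\ell:E(T)\to\{1,\dots,n\}}\ \prod_{v\in V(T)}D_{adj(v),\ell}\,h_{\alpha_{f(v)}}^d(z).$$
   Context: $z=(z_1,\dots,z_n)$, $D_i=\partial/\partial z_i$; harmonic means $\sum_iD_i^2P=0$. $\langle u,v\rangle=\sum_iu_iv_i$ is the standard $\mathbb{C}$-bilinear form on $\mathbb{C}^n$; $\alpha$ is isotropic if $\langle\alpha,\alpha\rangle=0$; $h_\alpha(z):=\langle\alpha,z\rangle$. The graph $\mathcal{G}(P)$, relative to the fixed expression of $P$, has vertex set $\{1,\dots,k\}$, with $i$ and $j$ connected by an edge if and only if $\langle\alpha_i,\alpha_j\rangle\ne0$. A tree is a connected, simply connected finite simple graph; $V(T)$ and $E(T)$ are its sets of vertices and edges. For $v\in V(T)$, $adj(v)=\{e_1,\dots,e_s\}$ is the set of edges of $T$ adjacent to $v$, and for $\ell:E(T)\to\{1,\dots,n\}$, $D_{adj(v),\ell}:=D_{\ell(e_1)}D_{\ell(e_2)}\cdots D_{\ell(e_s)}$. Define $$Q_{T,P}:=\sum_{\ell:E(T)\to\{1,\dots,n\}}\ \prod_{v\in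 V(T)}D_{adj(v),\ell}P.$$ $\Omega(T,\mathcal{G}(P))$ is the set of maps $f:V(T)\to\{1,\dots,k\}$ such that for any distinct adjacent vertices $u,v\in V(T)$, $f(u)$ and $f(v)$ are distinct and adjacent in $\mathcal{G}(P)$. *)

(* Defs.v *)
From HB Require Import structures.
From mathcomp Require Import all_boot all_order all_algebra.
From mathcomp Require Import complex mpoly reals.

Set Implicit Arguments.
Unset Strict Implicit.
Unset Printing Implicit Defensive.

Import GRing.Theory.

Local Open Scope ring_scope.

Section Polynomials.
Variables (C : fieldType) (n : nat).
Implicit Types (u v a : 'rV[C]_n) (p : {mpoly C[n]}).

Definition bform u v : C := \sum_(i < n) u 0 i * v 0 i.

Definition isotropic a : Prop := bform a a = 0.

Definition linform a : {mpoly C[n]} := \sum_(i < n) a 0 i *: 'X_i.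

Definition harmonic p : Prop := \sum_(i < n) p^`M(i)^`M(i) = 0.

End Polynomials.

(* [free] of vector.v requires a finite-dimensional ambient space, which
   {mpoly C[n]} is not. *)
Definition lin_indep (C : fieldType) (L : lmodType C) (k : nat)
    (x : 'I_k -> L) : Prop :=
  forall c : 'I_k -> C, \sum_(i < k) c i *: x i = 0 -> forall i, c i = 0.

Record sgraph := SGraph {
  svertex :> finType;
  sadj : rel svertex;
  sadj_sym : ssrbool.symmetric sadj;
  sadj_irrefl : irreflexive sadj }.

Section Graphs.
Variable T : sgraph.

(* [ucycle] also accepts [:: u; v] for every edge uv, hence the bound 2. *)
Definition is_tree : Prop :=
  [/\ (0 < #|T|)%N,
      forall u v : T, connect (@sadj T) u v &
      forall c : seq T, ucycle (@sadj T) c -> (size c <= 2)%N].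

Definition edge_set : {set {set T}} :=
  [set E | [exists u : T, exists v : T, sadj u v && (E == [set u; v])]].

Definition edge : Type := {E : {set T} | E \in edge_set}.

HB.instance Definition _ := Finite.on edge.

Definition incident (v : T) : {set edge} := [set E : edge | v \in val E].

End Graphs.

Section Q.
Variables (C : fieldType) (n : nat) (T : sgraph).

(* The enumeration order of the incident edges is irrelevant, as partial
   derivatives commute. *)
Definition Dadj (v : T) (l : {ffun edge T -> 'I_n}) (p : {mpoly C[n]}) :
    {mpoly C[n]} :=
  foldr (fun (E : edge T) (q : {mpoly C[n]}) => q^`M(l E)) p
        (enum (incident v)).

Definition QTP (p : {mpoly C[n]}) : {mpoly C[n]} :=
  \sum_(l : {ffun edge T -> 'I_n}) \prod_(v : T) Dadj v l p.

Definition pgraph (k : nat) (a : 'I_k -> 'rV[C]_n) : rel 'I_k :=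
  fun i j => bform (a i) (a j) != 0.

Definition Omega (k : nat) (G : rel 'I_k) : {set {ffun T -> 'I_k}} :=
  [set f : {ffun T -> 'I_k} | [forall u : T, forall v : T,
     sadj u v ==> (f u != f v) && G (f u) (f v)]].

End Q.

(* Main.v *)
(* Expanding Q_{T,P} multilinearly gives a sum over all maps f : V(T) -> {1..k}.
   The summand of f is a multiple of the product, over the edges uv of T, of
   <alpha_f(u), alpha_f(v)>. For f outside Omega one of these factors vanishes:
   an edge whose ends have the same image contributes <alpha, alpha> = 0 because
   alpha is isotropic. *)
Require Import Defs.
From HB Require Import structures.
From mathcomp Require Import all_boot all_order all_algebra.
From mathcomp Require Import complex mpoly reals.

Set Implicit Arguments.
Unset Strict Implicit.
Unset Printing Implicit Defensive.

Import GRing.Theory.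

Local Open Scope ring_scope.

Section LinearForms.
Variables (C : fieldType) (n : nat).
Implicit Types (a : 'rV[C]_n) (p : {mpoly C[n]}).

Lemma mderiv_linform a i : (linform a)^`M(i) = (a 0 i)%:MP.
Proof.
rewrite /linform linear_sum /= (bigD1 i) //= big1 ?addr0 => [|j ji].
  rewrite mderivZ mderivX mnm1E eqxx -[X in (X - _)%MM]add0m addmK.
  by rewrite mpolyX0 scale1r alg_mpolyC.
by rewrite mderivZ mderivX mnm1E (negPf ji) scale0r scaler0.
Qed.

Lemma mderiv_exp p m i : (p ^+ m)^`M(i) = (p ^+ m.-1 * p^`M(i)) *+ m.
Proof.
elim: m => [|m IHm]; first by rewrite expr0 -mpolyC1 mderivC mulr0n.
rewrite exprS mderivM IHm /= mulrS [_^`M(i) * _]mulrC; congr (_ + _).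
(* The identity [p * p ^+ m.-1 = p ^+ m] needs [m] positive; at [m = 0] the multiplicity 0 kills
   both sides instead. *)
by case: m {IHm} => [|m]; rewrite ?mulr0n ?mulr0 // mulrnAr mulrA -exprS.
Qed.

Lemma mderiv_linform_exp a m i :
  (linform a ^+ m)^`M(i) = (a 0 i *+ m) *: linform a ^+ m.-1.
Proof. by rewrite mderiv_exp mderiv_linform mulrC mul_mpolyC scalerMnl. Qed.

(* If [size s > d] both sides vanish, since then [d ^_ size s = 0]. *)
Lemma foldr_mderiv_linform_exp (I : Type) (s : seq I) (l : I -> 'I_n) a d :
  foldr (fun E q => q^`M(l E)) (linform a ^+ d) s =
    (\prod_(E <- s) a 0 (l E)) *: (linform a ^+ (d - size s) *+ d ^_ size s).
Proof.
elim: s => [|E s IHs] /=; first by rewrite big_nil subn0 scale1r mulr1n.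
rewrite IHs linearZ /= linearMn /= mderiv_linform_exp big_cons ffactnSr.
by rewrite subnS -!scalerMnl mulrC -scalerA !scalerMnr -mulrnA mulnC.
Qed.

End LinearForms.

Section TreeSums.
Variables (C : fieldType) (n : nat) (T : sgraph).
Implicit Types (l : {ffun edge T -> 'I_n}).

Lemma Dadj_sum v l (I : Type) (r : seq I) (p : I -> {mpoly C[n]}) :
  Dadj v l (\sum_(i <- r) p i) = \sum_(i <- r) Dadj v l (p i).
Proof.
rewrite /Dadj; elim: (enum _) => //= E s ->.
by rewrite linear_sum.
Qed.

(** Each [Dadj v l] is additive, so every vertex factor is a sum over indices; expanding the product
    over vertices means choosing one index per vertex, that is, a map [f]. *)
Lemma QTP_sum k (p : 'I_k -> {mpoly C[n]}) :
  QTP T (\sum_(i < k) p i) =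
    \sum_(f : {ffun T -> 'I_k}) \sum_(l : {ffun edge T -> 'I_n})
      \prod_(v : T) Dadj v l (p (f v)).
Proof.
rewrite /QTP exchange_big /=; apply: eq_bigr => l _.
rewrite -(bigA_distr_bigA (fun v i => Dadj v l (p i))) /=.
by apply: eq_bigr => v _; rewrite Dadj_sum.
Qed.

(** A coordinate [b v 0 (l E)] depends on [l] only through its value at [E], so the sum over
    labellings factors edge by edge. An edge with ends [u], [v] contributes [bform (b u) (b v)]. *)
Lemma sum_prod_Dadj_linform_exp (b : T -> 'rV[C]_n) d :
  \sum_(l : {ffun edge T -> 'I_n}) \prod_(v : T) Dadj v l (linform (b v) ^+ d) =
    (\prod_(E : edge T) \sum_(i < n) \prod_(v in val E) b v 0 i) *:
      \prod_(v : T) (linform (b v) ^+ (d - #|incident v|)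
                     *+ d ^_ #|incident v|).
Proof.
rewrite bigA_distr_bigA /= scaler_suml; apply: eq_bigr => l _.
under eq_bigr => v _ do rewrite /Dadj foldr_mderiv_linform_exp -cardE big_enum.
rewrite scaler_prod; congr (_ *: _).
(* Double counting of incident pairs: vertices with their edges become edges with their ends. *)
rewrite (exchange_big_dep xpredT) //=; apply: eq_bigr => E _.
by apply: eq_bigl => v; rewrite inE.
Qed.

Lemma sum_prod_Dadj_eq0 (b : T -> 'rV[C]_n) d u v :
    sadj u v -> bform (b u) (b v) = 0 ->
  \sum_(l : {ffun edge T -> 'I_n}) \prod_(w : T) Dadj w l (linform (b w) ^+ d)
    = 0.
Proof.
move=> uv buv0.
have uv_edge : [set u; v] \in edge_set T.
  by rewrite inE; apply/existsP; exists u; apply/existsP; exists v; rewrite uv /=.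
have u_neq_v : u != v by apply: contraTneq uv => ->; rewrite sadj_irrefl.
rewrite sum_prod_Dadj_linform_exp (bigD1 (Sub [set u; v] uv_edge : edge T)) //=.
rewrite [X in X * _](_ : _ = 0) ?mul0r ?scale0r //.
rewrite -[RHS]buv0; apply: eq_bigr => i _.
(* Since [u] and [v] differ, the product over [[set u; v]] has exactly the two factors of a term of
   [bform]. *)
by rewrite big_setU1 ?inE //= big_set1.
Qed.

End TreeSums.

Theorem proposition8p9 (R : realType) (n d k : nat)
    (P : {mpoly R[i][n]}) (alpha : 'I_k -> 'rV[R[i]]_n)
    (d_ge2 : (2 <= d)%N)
    (P_homog : P \is d.-homog)
    (P_harmonic : harmonic P)
    (P_eq : P = \sum_(i < k) linform (alpha i) ^+ d)
    (alpha_isotropic : forall i, isotropic (alpha i))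
    (powers_indep : lin_indep (fun i : 'I_k => linform (alpha i) ^+ d))
    (T : sgraph) (T_tree : is_tree T) :
  QTP T P =
    \sum_(f in Omega T (pgraph alpha))
      \sum_(l : {ffun edge T -> 'I_n})
        \prod_(v : T) Dadj v l (linform (alpha (f v)) ^+ d).
Proof.
rewrite P_eq QTP_sum [LHS](bigID (mem (Omega T (pgraph alpha)))) /=.
rewrite [X in _ + X]big1 ?addr0 // => f.
rewrite inE negb_forall => /existsP[u]; rewrite negb_forall => /existsP[v].
rewrite negb_imply negb_and /pgraph !negbK => /andP[uv fuv].
apply: (sum_prod_Dadj_eq0 (b := fun w => alpha (f w)) d uv).
(* Equal images are handled by isotropy; for images not adjacent in the graph, the form vanishes by
   definition. *)
by case/orP: fuv => /eqP // ->; apply: alpha_isotropic.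
Qed.
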